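(* Let $G=\{g_1,g_2,\dots\}$ be a countable amenable group and let $(F_n)_{n\in\mathbb{N}}$ be a F\o lner sequence of finite nonempty subsets of $G$ such that for every $\alpha\in[0,1)$ the series $\sum_{n=1}^\infty \alpha^{|F_n|}$ converges. Let $G$ act by measure-preserving transformations on a probability space $(X,\mu)$. Let $f\in L^\infty(\mu)$ be such that for every $\varepsilon>0$ there exists a finite set $K\subset G$ such that $f$ is $\varepsilon$-independent from the $\sigma$-algebra $\sigma(\{f\circ g: g\in G\setminus K\})$. Then \[ \lim_{n\to\infty} \frac1{|F_n|} \sum_{g\in F_n} f(gx) = \int f \, d\mu \qquad \text{for } \mu\text{-almost every } x\in X. \]
   Context: For $g\in G$ and $x\in X$, $gx$ denotes the image of $x$ under the measure-preserving transformation associated to $g$, and $f\circ g$ denotes the function $x\mapsto f(gx)$. For a family $\mathcal{F}\subset L^1(\mu)$, $\sigma(\mathcal{F})$ denotes the smallest sub-$\sigma$-algebra with respect to which every $f\in\mathcal{F}$ is measurable. A function $f$ is said to be $\varepsilon$-independent from a sub-$\sigma$-algebra $\Sigma_0$ if for every $B\in\Sigma_0$ with $\mu(B)>0$ one has $\left|\int_B f\, d\mu_B - \int f\, d\mu\right|<\varepsilon$, where $\mu_B(A)=\mu(A\cap B)/\mu(B)$ is the conditional measure on $B$. A F\o lner sequence is a sequence of finite nonempty sets $F_n\subset G$ with $|F_n g\,\triangle\, F_n|/|F_n|\to 0$ for every $g\in G$. *)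

(* Defs.v *)
From HB Require Import structures.
From mathcomp Require Import all_boot all_order all_algebra.
From mathcomp Require Import monoid.
From mathcomp Require Import all_classical all_reals all_analysis.
Set Implicit Arguments. Unset Strict Implicit. Unset Printing Implicit Defensive.
Import Order.TTheory GRing.Theory Num.Theory.
Import numFieldNormedType.Exports.
Local Open Scope classical_set_scope.
Local Open Scope ring_scope.

Definition rtranslate (G : groupType) (F : seq G) (g : G) : seq G :=
  [seq (h * g)%g | h <- F].

(* |A \triangle B| for duplicate-free sequences A, B. *)
Definition symdiff_card (G : groupType) (A B : seq G) : nat :=
  count (fun h => h \notin B) A + count (fun h => h \notin A) B.

Definition Folner (R : realType) (G : groupType) (F : nat -> seq G) : Prop :=
  (forall n, uniq (F n) /\ F n != [::]) /\
  forall g : G,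
    ((symdiff_card (rtranslate (F n) g) (F n))%:R / (size (F n))%:R : R)
      @[n --> \oo] --> 0.

Definition mp_action (R : realType) (G : groupType) (d : measure_display)
    (X : measurableType d) (mu : probability X R) (act : G -> X -> X) : Prop :=
  (forall x, act 1%g x = x) /\
  (forall g h x, act (g * h)%g x = act g (act h x)) /\
  (forall g, measurable_fun setT (act g)) /\
  (forall g A, measurable A -> mu (act g @^-1` A) = mu A).

Definition Linfty (R : realType) (d : measure_display) (X : measurableType d)
    (mu : probability X R) (f : X -> R) : Prop :=
  measurable_fun setT f /\ exists M : R, {ae mu, forall x, `|f x| <= M}.

Definition sigma_translates (R : realType) (G : groupType) (d : measure_display)
    (X : measurableType d) (act : G -> X -> X) (f : X -> R) (K : set G)
    : set (set X) :=
  <<s setT, [set A | exists g B, ~ K g /\ measurable B /\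
                                   A = (fun x => f (act g x)) @^-1` B] >>.

(* f is eps-independent from Sigma0: for every B in Sigma0 with mu B > 0,
   |int f d(mu_B) - int f dmu| < eps, where mu_B(A) = mu(A n B)/mu(B), so that
   int f d(mu_B) = (int_B f dmu) / mu(B). *)
Definition eps_independent (R : realType) (d : measure_display)
    (X : measurableType d) (mu : probability X R) (f : X -> R)
    (Sigma0 : set (set X)) (eps : R) : Prop :=
  forall B, Sigma0 B -> (0 < mu B)%E ->
    `| Rintegral mu B f / fine (mu B) - Rintegral mu setT f | < eps.

(* Main.v *)
(* Let u = f - c or c - f with c the mean of f, and let K be a finite set such
   that f is e-independent from the translates of f outside K. Each F_n splits
   greedily into k = |K| + 1 classes in each of which every element h comes,
   in a suitable order, after elements t with t h^-1 outside K only. Inside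
   such a class the factors exp (s (u o g - 2 e)) can be integrated out one by
   one, and for small s their product has integral at most 1. Markov's
   inequality then bounds the probability that the sum of u over F_n is at least
   3 e |F_n| by k alpha^|F_n| with alpha < 1, which is summable, and the
   Borel-Cantelli lemma concludes. *)
Require Import Defs.
From HB Require Import structures.
From mathcomp Require Import all_boot all_order all_algebra.
From mathcomp Require Import monoid.
From mathcomp Require Import all_classical all_reals all_analysis.
From mathcomp Require Import measurable_realfun ring lra.
Import Order.TTheory GRing.Theory Num.Theory.
Import numFieldNormedType.Exports.
Local Open Scope classical_set_scope.
Local Open Scope ring_scope.

(** * Bounded measurable functions and integrals against nonnegative weights *)

Section independence.
Context {R : realType} {d : measure_display} {X : measurableType d}.
Variable mu : probability X R.
Implicit Types (u v w : X -> R).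

(** The bound holds everywhere, not just almost everywhere, because the exponential estimates are
    pointwise. The class is closed under all operations used below and lies in the integrable
    functions of [mu]. *)
Definition bounded_measurable v : Prop :=
  measurable_fun setT v /\ exists M, forall x, `|v x| <= M.

Lemma bounded_measurable_integrable v :
  bounded_measurable v -> mu.-integrable setT (EFin \o v).
Proof.
move=> [mv [M vM]]; apply: measurable_bounded_integrable => //.
  exact: (fin_num_fun_lty (fin_num_measure mu)).
exists M; split; first exact: num_real.
by move=> y My x _; apply: le_trans (vM x) _; exact: ltW.
Qed.

Lemma bounded_measurableD u v : bounded_measurable u -> bounded_measurable v ->
  bounded_measurable (fun x => u x + v x).
Proof.
move=> [mu' [M uM]] [mv [N vN]]; split; first exact: measurable_funD.
by exists (M + N) => x; rewrite (le_trans (ler_normD _ _))// lerD.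
Qed.

Lemma bounded_measurableM u v : bounded_measurable u -> bounded_measurable v ->
  bounded_measurable (fun x => u x * v x).
Proof.
move=> [mu' [M uM]] [mv [N vN]]; split; first exact: measurable_funM.
by exists (M * N) => x; rewrite normrM ler_pM.
Qed.

Lemma bounded_measurable_cst (c : R) : bounded_measurable (fun=> c).
Proof. by split; [exact: measurable_cst|exists `|c|]. Qed.

Lemma bounded_measurable_indic (B : set X) : measurable B ->
  bounded_measurable (\1_B : X -> R).
Proof.
move=> mB; split; first exact: measurable_indic.
by exists 1 => x; rewrite indicE; case: (_ \in _); rewrite ?normr0 ?normr1.
Qed.

Lemma bounded_measurable_sum I (s : seq I) (v : I -> X -> R) :
  (forall i, bounded_measurable (v i)) ->
  bounded_measurable (fun x => \sum_(i <- s) v i x).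
Proof.
move=> vb; elim: s => [|i s IH].
  have -> : (fun x => \sum_(i <- [::]) v i x) = (fun=> 0).
    by apply/funext => x; rewrite big_nil.
  exact: bounded_measurable_cst.
have -> : (fun x => \sum_(j <- i :: s) v j x) =
    (fun x => v i x + \sum_(j <- s) v j x).
  by apply/funext => x; rewrite big_cons.
exact: bounded_measurableD.
Qed.

Lemma Rintegral_probability_cst (c : R) : \int[mu]_x c = c.
Proof.
rewrite Rintegral_cst// -[LHS]/(c * fine (mu setT)).
by rewrite probability_setT mulr1.
Qed.

Lemma Rintegral_bounded_sum I (s : seq I) (v : I -> X -> R) :
  (forall i, bounded_measurable (v i)) ->
  \int[mu]_x (\sum_(i <- s) v i x) = \sum_(i <- s) \int[mu]_x v i x.
Proof.
move=> vb; elim: s => [|i s IH].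
  under eq_Rintegral do rewrite big_nil.
  by rewrite Rintegral_probability_cst big_nil.
under eq_Rintegral do rewrite big_cons.
rewrite RintegralD ?IH ?big_cons//; apply: bounded_measurable_integrable => //.
exact: bounded_measurable_sum.
Qed.

Lemma Rintegral_indicM v (B : set X) :
  \int[mu]_x (\1_B x * v x) = \int[mu]_(x in B) v x.
Proof.
rewrite [RHS]Rintegral_mkcond; apply: eq_Rintegral => x _.
by rewrite /patch indicE; case: (_ \in _); rewrite ?mul1r ?mul0r.
Qed.

(** The sum counts the integers from [1] to [N] that are at most [y], so it is the floor of [y] cut
    off at [N]. The induction carries the exact value [N] when [N <= y], since the next step starts
    from it. *)
Lemma sum_threshold (y : R) (N : nat) : 0 <= y ->
  \sum_(k < N) ((k.+1%:R <= y)%R%:R : R) <= y /\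
  (y <= N%:R -> y - 1 <= \sum_(k < N) ((k.+1%:R <= y)%R%:R : R)).
Proof.
move=> y0; suff H : if N%:R <= y then \sum_(k < N) ((k.+1%:R <= y)%R%:R : R) = N%:R
    else y - 1 <= \sum_(k < N) ((k.+1%:R <= y)%R%:R : R) <= y.
  move: H; case: leP => [Ny ->|_ /andP[? ?]]; last by split.
  by split=> // yN; rewrite lerBlDr (le_trans yN)// lerDl.
elim: N => [|N IH]; first by rewrite big_ord0 y0.
rewrite big_ord_recr/=; case: (leP N.+1%:R y) => [Ny|yN] /=.
  move: IH; have -> : N%:R <= y by apply: le_trans Ny; rewrite ler_nat.
  by move=> ->; rewrite -(natr1 N).
move: IH; rewrite addr0; case: leP => // Ny ->.
rewrite Ny andbT; move: yN; rewrite -natr1; lra.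
Qed.

(* The weight [w] is approximated within [L / N] by a nonnegative combination
   of indicators of its superlevel sets. *)
Lemma Rintegral_mulr_le0 (S : set (set X)) v w (L : R) :
  bounded_measurable v -> bounded_measurable w ->
  (forall x, 0 <= w x <= L) -> S `<=` measurable ->
  (forall t, S [set x | t <= w x]) ->
  (forall B, S B -> \int[mu]_(x in B) v x <= 0) ->
  \int[mu]_x (w x * v x) <= 0.
Proof.
move=> vb wb wL Sm Sw Sv; have [_ [C vC]] := vb.
(* A point of [X] is what yields [0 <= C] and [0 <= L]. *)
have [x0|X0] := pselect (exists x : X, True); last first.
  have -> : [set: X] = set0.
    by apply/seteqP; split=> // x _; apply: X0; exists x.
  by rewrite Rintegral_set0.
have {x0} [C0 L0] : 0 <= C /\ 0 <= L.
  case: x0 => x _; split; first exact: le_trans (vC x).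
  by have /andP[] := wL x; exact: le_trans.
suff H (N : nat) : (0 < N)%N -> \int[mu]_x (w x * v x) <= C * L / N%:R.
  apply/ler_addgt0Pr => e e0; rewrite add0r.
  pose N := (Num.truncn (e^-1 * (C * L))).+1.
  apply: (le_trans (H N isT)).
  rewrite ler_pdivrMr ?ltr0n// -ler_pdivrMl//.
  by rewrite ltW// /N truncnS_gt.
move=> N0; have [L00|Lpos] := leP L 0.
  have w0 x : w x = 0 by apply/eqP; rewrite eq_le; move: (wL x); lra.
  under eq_Rintegral do rewrite w0 mul0r.
  by rewrite Rintegral_probability_cst divr_ge0// mulr_ge0.
pose e := L / N%:R; have e0 : 0 < e by rewrite divr_gt0// ltr0n.
pose B (k : nat) := [set x | k.+1%:R * e <= w x].
have BE k x : (\1_(B k) x : R) = (k.+1%:R <= w x / e)%R%:R.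
  rewrite indicE ler_pdivlMr//; congr ((nat_of_bool _)%:R).
  by apply/idP/idP; rewrite inE.
have mB k : measurable (B k) by exact/Sm/Sw.
pose g x := \sum_(k < N) (e * (\1_(B k) x * v x)).
have gb : bounded_measurable g.
  apply: bounded_measurable_sum => k; apply: bounded_measurableM.
    exact: bounded_measurable_cst.
  by apply: bounded_measurableM => //; exact: bounded_measurable_indic.
(* The difference of [w x * v x] and [g x] is [e * ((w x / e - s) * v x)], where [s] is the number
   of levels reached. Rounding down loses at most [1], so the error is at most [e * C]. *)
have gle x : w x * v x <= g x + C * L / N%:R.
  rewrite /g -mulr_sumr -mulr_suml.
  under eq_bigr do rewrite BE.
  have /andP[wx0 wxL] := wL x.
  have [|lo hi] := @sum_threshold (w x / e) N; first by rewrite divr_ge0// ltW.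
  set s := \sum_(k < N) _ in lo hi *.
  have {}hi : w x / e - 1 <= s.
    by apply: hi; rewrite ler_pdivrMr// /e mulrC divfK// pnatr_eq0 -lt0n.
  have [s0 s1] : 0 <= w x / e - s /\ w x / e - s <= 1 by split; lra.
  rewrite -lerBlDl (_ : _ - _ = e * ((w x / e - s) * v x)); last first.
    by field; rewrite gt_eqF.
  rewrite (_ : C * L / _ = e * C); last by rewrite /e; ring.
  rewrite ler_pM2l// (le_trans (ler_norm _))// normrM.
  by rewrite (ger0_norm s0) -[leRHS]mul1r ler_pM.
apply: (@le_trans _ _ (\int[mu]_x (g x + C * L / N%:R))).
  apply: le_Rintegral => //; apply: bounded_measurable_integrable.
  - exact: bounded_measurableM.
  - by apply: bounded_measurableD => //; exact: bounded_measurable_cst.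
have cstb := bounded_measurable_cst (C * L / N%:R).
rewrite RintegralD//; try exact: bounded_measurable_integrable.
rewrite Rintegral_probability_cst gerDr /g Rintegral_bounded_sum; last first.
  move=> k; apply: bounded_measurableM; first exact: bounded_measurable_cst.
  by apply: bounded_measurableM => //; exact: bounded_measurable_indic.
apply: sumr_le0 => k _; rewrite RintegralZl//; last first.
  apply: bounded_measurable_integrable.
  by apply: bounded_measurableM => //; exact: bounded_measurable_indic.
by rewrite pmulr_rle0// Rintegral_indicM; apply: Sv; exact: Sw.
Qed.

End independence.

(** * A quadratic bound for the exponential and a greedy coloring *)

Lemma expR_le_quadratic {R : realType} (x : R) : `|x| <= 2^-1 ->
  expR x <= 1 + x + 2 * x ^+ 2.
Proof.
rewrite ler_norml => /andP[xlo xhi].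
have x1 : 0 < 1 - x by lra.
(* Invert [1 - x <= expR (- x)]. What remains is that [(1 + x + 2 * x ^+ 2) * (1 - x)] is at least
   [1], which uses [2 * x <= 1]. *)
have /le_trans -> // : expR x <= (1 - x)^-1.
  rewrite -[leLHS]invrK -expRN lef_pV2 ?posrE ?expR_gt0//.
  exact: expR_ge1Dx.
rewrite -[leLHS]mul1r ler_pdivrMr//.
rewrite (_ : _ * (1 - x) = 1 + x ^+ 2 * (1 - 2 * x)); last by ring.
by rewrite lerDl mulr_ge0 ?sqr_ge0//; lra.
Qed.

(* Only the elements [k * h] with [k] in [K] can conflict with a new element
   [h], so [size K + 1] colors suffice for a greedy coloring. *)
Lemma separated_coloring {G : groupType} (K s : seq G) : uniq s ->
  exists c : G -> nat, (forall g, c g < (size K).+1)%N /\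
    pairwise (fun h t => (c h == c t) ==> ((t * h^-1)%g \notin K)) s.
Proof.
elim: s => [|h s IH /=]; first by move=> _; exists (fun=> 0%N).
move=> /andP[hs /IH[c [ck cs]]].
(* These are at most [size K] forbidden colors, so one of the [size K + 1] colors is free for [h].
   Recoloring [h] leaves [s] untouched because [h] is not in [s]. *)
pose forb := [seq c (k * h)%g | k <- K].
have [i ik iforb] : exists2 i, (i < (size K).+1)%N & i \notin forb.
  apply: contrapT => H.
  have : (size (iota 0 (size K).+1) <= size forb)%N.
    apply: uniq_leq_size; first exact: iota_uniq.
    move=> i; rewrite mem_iota add0n => /andP[_ iK].
    by apply: contrapT => /negP iforb; apply: H; exists i.
  by rewrite size_iota size_map ltnn.
exists (fun g => if g == h then i else c g); split; first by move=> g; case: ifP.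
have nh t : t \in s -> (t == h) = false.
  by move=> ts; apply/negP => /eqP th; rewrite -th ts in hs.
rewrite /= eqxx; apply/andP; split.
  apply/allP => t ts; rewrite nh//; apply/implyP => /eqP it.
  apply: contra iforb => tK; apply/mapP; exists (t * h^-1)%g => //.
  by rewrite mulgVK.
move: cs; apply: (@sub_in_pairwise _ (mem s)); last exact/allP.
by move=> g t gs ts; rewrite /= !nh.
Qed.

(** * Exponential moments along a separated list *)

Section moments.
Context {R : realType} {G : groupType} {d : measure_display}.
Context {X : measurableType d} (mu : probability X R) (act : G -> X -> X).
Hypothesis mp : mp_action mu act.

Lemma bounded_measurable_act (w : X -> R) g : bounded_measurable w ->
  bounded_measurable (fun x => w (act g x)).
Proof.
case: mp => _ [_ [mact _]] [mw [M wM]]; split; last by exists M.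
exact: measurableT_comp.
Qed.

Lemma bounded_measurable_expR (w : X -> R) : bounded_measurable w ->
  bounded_measurable (fun x => expR (w x)).
Proof.
move=> [mw [M wM]]; split; first exact: measurableT_comp.
exists (expR M) => x; rewrite ger0_norm ?expR_ge0// ler_expR.
exact: le_trans (ler_norm _) (wM x).
Qed.

Lemma Rintegral_act (w : X -> R) g : bounded_measurable w ->
  \int[mu]_x w (act g x) = \int[mu]_x w x.
Proof.
move=> wb; have [_ [_ [mact muact]]] := mp.
rewrite /Rintegral; congr fine.
have := @integral_pushforward _ _ _ _ R (act g) (mact g) mu setT (EFin \o w).
rewrite preimage_setT => /= <- //.
- by apply: eq_measure_integral => A mA _; rewrite /= /pushforward muact.
- by apply/measurable_EFinP; exact: wb.1.
- by apply: bounded_measurable_integrable; exact: bounded_measurable_act.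
Qed.

Lemma sigma_translates_measurable (u : X -> R) (K : set G) :
  measurable_fun setT u -> sigma_translates act u K `<=` measurable.
Proof.
move=> mu'; have [_ [_ [mact _]]] := mp.
apply: smallest_sub; first exact: sigma_algebra_measurable.
move=> _ [g [B [_ [mB ->]]]]; rewrite -[X in measurable X]setTI.
by apply: (measurableT_comp mu' (mact g)).
Qed.

Lemma sigma_translates_sum (u : X -> R) (K s : seq G) (a : R) (B : set R) :
  all [predC K] s -> measurable B ->
  sigma_translates act u [set` K]
    ((fun x => \sum_(g <- s) (u (act g x) - a)) @^-1` B).
Proof.
move=> sK mB.
pose S := [set A | exists g B, ~ [set` K] g /\ measurable B /\
                     A = (fun x => u (act g x)) @^-1` B].
(* Over [X] with the generated sigma-algebra the claim is measurability of a finite sum, whose terms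
   are measurable by the choice of generators. *)
suff mS : measurable_fun [set: g_sigma_algebraType S]
    (fun x => \sum_(g <- s) (u (act g x) - a)).
  by have := mS measurableT B mB; rewrite setTI.
elim: s sK => [_|g s IH /= /andP[gK sK]].
  by under eq_fun do rewrite big_nil; exact: measurable_cst.
under eq_fun do rewrite big_cons.
apply: measurable_funD; last exact: IH.
apply: measurable_funB; last exact: measurable_cst.
move=> _ C mC; rewrite setTI; apply: sub_sigma_algebra.
by exists g, C; split=> //; exact/negP.
Qed.

Variables (u : X -> R) (K : seq G) (e s : R).
Hypothesis ub : bounded_measurable u.
(** For [u] of mean zero this is the upper half of [e]-independence multiplied by [mu B], so null
    sets [B] need no exception. *)
Hypothesis uK : forall B, sigma_translates act u [set` K] B ->
  \int[mu]_(x in B) (u x - e) <= 0.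

Let Z (l : seq G) x := expR (s * \sum_(g <- l) (u (act g x) - 2 * e)).

Let Zb l : bounded_measurable (Z l).
Proof.
apply: bounded_measurable_expR; apply: bounded_measurableM.
  exact: bounded_measurable_cst.
apply: bounded_measurable_sum => g; apply: bounded_measurableD.
  exact: bounded_measurable_act.
exact: bounded_measurable_cst.
Qed.

Let ueb : bounded_measurable (fun x => u x - e).
Proof. by apply: bounded_measurableD => //; exact: bounded_measurable_cst. Qed.

(* Translating by [h^-1] moves the average of [u] over the past [l] into
   the sigma-algebra from which [u] is almost independent. *)
Lemma Rintegral_past_le0 (h : G) (l : seq G) :
  all (fun t => (t * h^-1)%g \notin K) l ->
  \int[mu]_x (expR (s * \sum_(g <- l) (u (act g x) - 2 * e)) *
     (u (act h x) - e)) <= 0.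
Proof.
move=> lK; have [act1 [actM _]] := mp.
pose w x := Z l (act h^-1%g x).
have wE x : w x = expR (s * \sum_(g <- [seq (t * h^-1)%g | t <- l])
    (u (act g x) - 2 * e)).
  by rewrite /w /Z big_map; under [in RHS]eq_bigr do rewrite actM.
have wb : bounded_measurable w by exact: bounded_measurable_act.
have [_ [L wL]] := wb.
rewrite -/(Z l) (_ : (fun x => _) = (fun x => w (act h x) * (u (act h x) - e))).
  rewrite (Rintegral_act (fun x => w x * (u x - e))); last first.
    exact: bounded_measurableM.
  apply: (@Rintegral_mulr_le0 _ _ _ _ (sigma_translates act u [set` K]) _ _ L).
  - exact: ueb.
  - exact: wb.
  - by move=> x; rewrite expR_ge0/= (le_trans (ler_norm _)).
  - apply: sigma_translates_measurable; exact: ub.1.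
  (* A superlevel set of [w] is the preimage of a measurable set of reals under a sum of translates
     by the elements [t * h^-1], all outside [K]. *)
  - move=> t; rewrite (funext wE).
    have mt : measurable [set r : R | t <= expR (s * r)].
      rewrite -[X in measurable X]setTI.
      apply: (@measurable_fun_ler _ _ _ _ (cst t) (fun r => expR (s * r))) => //.
      exact: measurableT_comp.
    apply: (sigma_translates_sum u K _ (2 * e) _ _ mt).
    by rewrite all_map.
  - exact: uK.
by apply/funext => x; rewrite /w /Z -(actM h^-1%g h) mulVg act1.
Qed.

(** Induction on [l]: the factor of the head [h] is at most [1 + s * (u (act h x) - e)], and by
    [Rintegral_past_le0] its second summand contributes nothing positive when integrated against the
    factors of the tail. *)
Lemma Rintegral_expR_separated_le1 (l : seq G) : 0 < s ->
  (forall x, expR (s * (u x - 2 * e)) <= 1 + s * (u x - e)) ->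
  pairwise (fun h t => (t * h^-1)%g \notin K) l ->
  \int[mu]_x expR (s * \sum_(g <- l) (u (act g x) - 2 * e)) <= 1.
Proof.
move=> s0 us; elim: l => [_|h l IH /= /andP[hl ll]].
  under eq_Rintegral do rewrite big_nil mulr0 expR0.
  by rewrite Rintegral_probability_cst.
have Zub : bounded_measurable (fun x => Z l x * (u (act h x) - e)).
  apply: bounded_measurableM => //.
  exact: (bounded_measurable_act _ h ueb).
have sZub : bounded_measurable (fun x => s * (Z l x * (u (act h x) - e))).
  by apply: bounded_measurableM => //; exact: bounded_measurable_cst.
apply: (@le_trans _ _ (\int[mu]_x (Z l x + s * (Z l x * (u (act h x) - e))))).
  apply: le_Rintegral => //; first exact: (bounded_measurable_integrable _ _ (Zb _)).
    by apply: bounded_measurable_integrable; exact: bounded_measurableD.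
  move=> x _; rewrite big_cons mulrDr expRD -/(Z l x).
  rewrite [leRHS](_ : _ = (1 + s * (u (act h x) - e)) * Z l x); last by ring.
  by rewrite ler_wpM2r// expR_ge0.
rewrite RintegralD//; try exact: bounded_measurable_integrable.
rewrite RintegralZl//; last exact: bounded_measurable_integrable.
rewrite -[leRHS]addr0 lerD//; first exact: IH.
by rewrite pmulr_rle0//; exact: Rintegral_past_le0.
Qed.

End moments.

(** Passing from [2 * e] to [e] leaves room [s * e], which absorbs the quadratic term of the
    exponential once [s] is small. *)
Lemma exists_linearized_expR {R : realType} (M e : R) : 0 < e ->
  exists s, 0 < s /\
    forall y, `|y| <= M -> expR (s * (y - 2 * e)) <= 1 + s * (y - e).
Proof.
move=> e0; pose C := `|M| + 2 * e + 1.
have M0 := normr_ge0 M.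
have C0 : 0 < C by rewrite /C; lra.
(* [C] bounds both [y - 2 * e] and [e]. The choice [2 * s * C ^+ 2 = e] bounds the quadratic term by
   [s * e] and, as [e <= C], keeps the exponent within [2^-1]. *)
exists (e / (2 * C ^+ 2)); split.
  by rewrite divr_gt0// mulr_gt0// exprn_gt0.
move=> y yM; set s := e / _; set z := y - 2 * e.
have s0 : 0 < s by rewrite divr_gt0// mulr_gt0// exprn_gt0.
have sC : 2 * s * C ^+ 2 = e by rewrite /s; field; rewrite gt_eqF.
have zC : `|z| <= C.
  rewrite (le_trans (ler_normB _ _))// (ger0_norm (_ : 0 <= 2 * e)); last by lra.
  by rewrite /C; have := ler_norm M; lra.
have szC : 2 * s * z ^+ 2 <= e.
  rewrite -sC ler_pM2l; last by rewrite mulr_gt0.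
  by rewrite -(real_normK (num_real z)) lerXn2r ?nnegrE// ltW.
have sz : `|s * z| <= 2^-1.
  rewrite normrM (gtr0_norm s0) (@le_trans _ _ (s * C))//.
    by rewrite ler_pM2l.
  rewrite -(ler_pM2r (_ : 0 < 2 * C)) ?mulr_gt0//.
  rewrite (_ : _ * (2 * C) = e); last by rewrite -sC; ring.
  by rewrite mulKf// /C; lra.
apply: le_trans (expR_le_quadratic _ sz) _.
rewrite -addrA lerD2l (_ : _ + _ = s * (z + 2 * s * z ^+ 2)); last by ring.
by rewrite ler_pM2l//; move: szC; rewrite /z; lra.
Qed.

(** * Large deviations and the Borel-Cantelli lemma *)

Section deviations.
Context {R : realType} {G : groupType} {d : measure_display}.
Context {X : measurableType d} (mu : probability X R) (act : G -> X -> X).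
Hypothesis mp : mp_action mu act.
Variables (u : X -> R) (K : seq G) (e : R).
Hypothesis ub : bounded_measurable u.
Hypothesis e0 : 0 < e.
Hypothesis uK : forall B, sigma_translates act u [set` K] B ->
  \int[mu]_(x in B) (u x - e) <= 0.

Let k := (size K).+1.
(** Of the threshold [3 * e] per element, [2 * e] is spent on the shift in the exponential moments;
    the remaining [e] gives the exponential decay. *)
Let dev (F : seq G) := [set x | 3 * e * (size F)%:R <= \sum_(g <- F) u (act g x)].

Lemma measurable_dev (F : seq G) : measurable (dev F).
Proof.
rewrite -[dev F]setTI; apply: (@measurable_fun_ler _ _ _ _ (cst _)) => //.
have [//] : bounded_measurable (fun x => \sum_(g <- F) u (act g x)).
by apply: bounded_measurable_sum => g; exact: (bounded_measurable_act _ _ mp).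
Qed.

(* Chernoff's bound in each color class [i]; by the choice of the threshold, on
   the deviation event some class sum [S i] is at least [e * size F / k]. *)
Lemma deviation_bound : exists2 alpha : R, 0 <= alpha < 1 &
  forall F, uniq F -> fine (mu (dev F)) <= k%:R * alpha ^+ size F.
Proof.
have [_ [M uM]] := ub.
have [s [s0 us]] := exists_linearized_expR M e e0.
have k0 : 0 < k%:R :> R by rewrite ltr0n.
have sek0 : 0 < s * e / k%:R by rewrite divr_gt0// mulr_gt0.
exists (expR (- (s * e / k%:R))).
  by rewrite expR_ge0/= expR_lt1 oppr_lt0.
move=> F Fu; have [c [ck csep]] := separated_coloring K F Fu.
pose S (i : 'I_k) x := \sum_(g <- [seq g <- F | c g == i]) (u (act g x) - 2 * e).
pose Y x := \sum_(i < k) expR (s * S i x).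
have Sb i : bounded_measurable (fun x => expR (s * S i x)).
  apply: bounded_measurable_expR; apply: bounded_measurableM.
    exact: bounded_measurable_cst.
  apply: bounded_measurable_sum => g; apply: bounded_measurableD.
    exact: (bounded_measurable_act _ _ mp).
  exact: bounded_measurable_cst.
have Yb : bounded_measurable Y by exact: bounded_measurable_sum.
have Yk : \int[mu]_x Y x <= k%:R.
  rewrite Rintegral_bounded_sum//.
  have -> : k%:R = \sum_(i < k) (1 : R) by rewrite sumr_const card_ord.
  apply: ler_sum => i _.
  apply: (@Rintegral_expR_separated_le1 _ _ _ _ _ _ mp u K e s) => //.
    by move=> x; exact: us.
  have := pairwise_filter (fun g => c g == i) csep.
  apply: sub_in_pairwise; last exact: filter_all.
  move=> h t; rewrite -!topredE /= => /eqP -> /eqP ->.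
  by rewrite eqxx.
pose a := expR (s * e / k%:R * (size F)%:R).
have a0 : 0 < a by exact: expR_gt0.
have YA x : \1_(dev F) x * a <= Y x.
  rewrite indicE; case: (boolP (x \in dev F)); last first.
    by rewrite mul0r => _; apply: sumr_ge0 => i _; exact: expR_ge0.
  rewrite inE mul1r /dev/= => xF.
  (* The [k] class sums add up to the sum of [u (act g x) - 2 * e] over [F], which is at least
     [e * size F] on the deviation event; some class reaches the average. *)
  have [i Si] : exists i, e / k%:R * (size F)%:R <= S i x.
    apply: contrapT => /forallNP nS.
    have : \sum_(i < k) S i x < \sum_(i < k) (e / k%:R * (size F)%:R).
      apply: ltr_sum => [|i _]; last by rewrite ltNge; exact/negP.
      by apply/hasP; exists ord0; rewrite ?mem_index_enum.
    rewrite sumr_const card_ord.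
    have -> : (e / k%:R * (size F)%:R) *+ k = e * (size F)%:R.
      by rewrite -[LHS]mulr_natr; field; rewrite gt_eqF.
    apply/negP; rewrite -leNgt.
    rewrite (_ : \sum_(i < k) _ = \sum_(g <- F) (u (act g x) - 2 * e)).
      by rewrite sumrB big_const_seq count_predT iter_addr_0 -mulr_natr; lra.
    under eq_bigr do rewrite /S big_filter.
    rewrite (exchange_big_dep predT)//=; apply: eq_bigr => g _.
    by rewrite (big_pred1 (Ordinal (ck g))).
  rewrite /Y (bigD1 i)//= -[leLHS]addr0 lerD//; last first.
    by apply: sumr_ge0 => j _; exact: expR_ge0.
  by rewrite ler_expR -!mulrA ler_pM2l// mulrA.
have -> : expR (- (s * e / k%:R)) ^+ size F = a^-1.
  by rewrite -expRM_natl mulrN expRN mulrC.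
rewrite ler_pdivlMr//.
(* Markov's inequality: integrate [YA]. *)
rewrite (le_trans _ Yk)// mulrC -Rintegral_cst; last exact: measurable_dev.
rewrite -Rintegral_indicM; apply: le_Rintegral => //.
  apply: bounded_measurable_integrable; apply: bounded_measurableM.
    by apply: bounded_measurable_indic; exact: measurable_dev.
  exact: bounded_measurable_cst.
exact: bounded_measurable_integrable.
Qed.

Lemma ae_eventually_small (F : nat -> seq G) : (forall n, uniq (F n)) ->
  (forall alpha : R, 0 <= alpha < 1 ->
     cvg (series (fun n => alpha ^+ size (F n)) @ \oo)) ->
  {ae mu, forall x, \forall n \near \oo,
     \sum_(g <- F n) u (act g x) < 3 * e * (size (F n))%:R}.
Proof.
move=> Fu Fs; have [alpha alpha01 devF] := deviation_bound.
(* The exceptional set consists of the points lying in infinitely many deviation events; it is null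
   because the bounds [v n] are summable. *)
exists (lim_sup_set (fun n => dev (F n))); split.
- apply: bigcap_measurable => // n _; apply: bigcup_measurable => m _.
  exact: measurable_dev.
- apply: lim_sup_set_cvg0 => [n|]; first exact: measurable_dev.
  pose v n : R := k%:R * alpha ^+ size (F n).
  have vcvg : cvg (series v @ \oo).
    rewrite (_ : series v = k%:R *: series (fun n => alpha ^+ size (F n))).
      by apply: is_cvgZr; exact: Fs.
    by apply/funext => n; rewrite /series/= /v -mulr_sumr.
  apply: (@le_lt_trans _ _ (\sum_(n <oo) (v n)%:E)%E).
    apply: lee_nneseries => // n _.
    by rewrite -[leLHS]fineK ?fin_num_measure// ?lee_fin ?devF//; exact: measurable_dev.
  rewrite (_ : limn _ = (limn (series v))%:E) ?ltry//.
  rewrite -EFin_lim//; congr (limn _); apply/funext => n.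
  by rewrite /= sumEFin.
- move=> x /= H n _; apply: contrapT => nx; apply: H.
  exists n => // m /= nm; rewrite ltNge; apply/negP => mx.
  by apply: nx; exists m.
Qed.

End deviations.

(** * From deviation bounds to almost everywhere convergence *)

Section convergence.
Context {R : realType} {G : groupType} {d : measure_display}.
Context {X : measurableType d} (mu : probability X R) (act : G -> X -> X).
Hypothesis mp : mp_action mu act.

(** Lets independence pass from [f] to its centred versions of either sign and to its truncation. *)
Lemma sigma_translates_comp (phi : R -> R) (f : X -> R) (K : set G) :
  measurable_fun setT phi ->
  sigma_translates act (phi \o f) K `<=` sigma_translates act f K.
Proof.
move=> mphi; apply: smallest_sub; first exact: smallest_sigma_algebra.
move=> _ [g [B [gK [mB ->]]]]; apply: sub_gen_smallest.
exists g, (phi @^-1` B); split=> //; split=> //.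
by rewrite -[phi @^-1` B]setTI; exact: mphi.
Qed.

Lemma eps_independent_affine (f : X -> R) (S : set (set X)) (sg e : R) :
  bounded_measurable f -> S `<=` measurable -> `|sg| = 1 ->
  eps_independent mu f S e ->
  forall B, S B ->
    \int[mu]_(x in B) (sg * (f x - \int[mu]_x f x) - e) <= 0.
Proof.
move=> fb Sm sg1 fe B SB; have mB := Sm _ SB.
set c := \int[mu]_x f x.
have fi : mu.-integrable B (EFin \o f).
  apply: (@integrableS _ _ _ _ setT) => //.
  exact: bounded_measurable_integrable.
have -> : \int[mu]_(x in B) (sg * (f x - c) - e) =
    sg * (\int[mu]_(x in B) f x) - (sg * c + e) * fine (mu B).
  under eq_Rintegral do rewrite mulrBr -addrA -opprD.
  rewrite RintegralB//; last first.
    exact: (finite_measure_integrable_cst _ (sg * c + e)).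
    apply: (@integrableS _ _ _ _ setT) => //.
    apply: bounded_measurable_integrable; apply: bounded_measurableM => //.
    exact: bounded_measurable_cst.
  by rewrite RintegralZl// Rintegral_cst.
(* [eps_independent] is silent on null sets, but there both sides vanish. *)
have := measure_ge0 mu B; rewrite le_eqVlt => /predU1P[/esym B0|B0].
  rewrite B0/= mulr0 subr0 /Rintegral null_set_integral ?mulr0//.
  exact: measurable_int fi.
have := fe B SB B0; rewrite -/c.
have m0 : 0 < fine (mu B).
  by rewrite fine_gt0// B0/= -ge0_fin_numE ?fin_num_measure.
rewrite -[`|_ - _|]mul1r -sg1 -normrM => /ltW/ler_normlW.
rewrite mulrBr lerBlDr mulrA ler_pdivrMr//; lra.
Qed.

(** The one-sided bound, applied to the centred [f] with the signs [1] and [-1], gives the two sides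
    of the absolute value. *)
Lemma ae_eventually_close (f : X -> R) (F : nat -> seq G) (e : R) (K : seq G) :
  bounded_measurable f -> (forall n, uniq (F n)) ->
  (forall alpha : R, 0 <= alpha < 1 ->
     cvg (series (fun n => alpha ^+ size (F n)) @ \oo)) -> 0 < e ->
  eps_independent mu f (sigma_translates act f [set` K]) e ->
  {ae mu, forall x, \forall n \near \oo,
     `|\sum_(g <- F n) f (act g x) - (size (F n))%:R * \int[mu]_x f x|
       <= 3 * e * (size (F n))%:R}.
Proof.
move=> fb Fu Fs e0 fe; set c := \int[mu]_x f x.
have H (sg : R) : `|sg| = 1 -> {ae mu, forall x, \forall n \near \oo,
    \sum_(g <- F n) sg * (f (act g x) - c) < 3 * e * (size (F n))%:R}.
  move=> sg1; apply: (ae_eventually_small mu act mp (fun x => sg * (f x - c)) K) => //.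
    apply: bounded_measurableM; first exact: bounded_measurable_cst.
    by apply: bounded_measurableD => //; exact: bounded_measurable_cst.
  move=> B SB; apply: (eps_independent_affine _ _ _ _ fb _ sg1 fe).
    exact: (sigma_translates_measurable _ _ mp _ _ fb.1).
  move: SB; apply: (sigma_translates_comp (fun y => sg * (y - c))).
  apply: measurable_funM; first exact: measurable_cst.
  by apply: measurable_funB => //; exact: measurable_cst.
have sumE sg n x : \sum_(g <- F n) sg * (f (act g x) - c) =
    sg * (\sum_(g <- F n) f (act g x) - (size (F n))%:R * c).
  by rewrite -mulr_sumr sumrB big_const_seq count_predT iter_addr_0 mulr_natl.
apply: filterS2 (H 1 (normr1 _)) (H (-1) (normrN1 _)) => x.
apply: filterS2 => n; rewrite !sumE mul1r mulN1r => /ltW h1 /ltW h2.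
by rewrite ler_norml h1 andbT lerNl.
Qed.

Lemma ae_cvg_average_bounded (f : X -> R) (F : nat -> seq G) :
  bounded_measurable f -> (forall n, uniq (F n) /\ F n != [::]) ->
  (forall alpha : R, 0 <= alpha < 1 ->
     cvg (series (fun n => alpha ^+ size (F n)) @ \oo)) ->
  (forall e : R, 0 < e -> exists K : set G, finite_set K /\
       eps_independent mu f (sigma_translates act f K) e) ->
  {ae mu, forall x,
     ((size (F n))%:R^-1 * \sum_(g <- F n) f (act g x))
       @[n --> \oo] --> \int[mu]_x f x}.
Proof.
move=> fb Fu Fs fK; set c := \int[mu]_x f x.
(* Tolerances of the form [m.+1%:R^-1] suffice, so only countably many null sets have to be
   united. *)
have H m : {ae mu, forall x, \forall n \near \oo,
     `|\sum_(g <- F n) f (act g x) - (size (F n))%:R * c|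
       <= 3 * m.+1%:R^-1 * (size (F n))%:R}.
  have m0 : 0 < m.+1%:R^-1 :> R by rewrite invr_gt0.
  have [_ [/finite_seqP[K ->] Ke]] := fK _ m0.
  by apply: (ae_eventually_close _ _ _ K) => // n; have [] := Fu n.
move/ae_foralln : H; apply: filterS => x Hx.
apply/cvgrPdist_le => e e0.
pose m := Num.truncn (e^-1 * 3).
have me : 3 * m.+1%:R^-1 <= e.
  by rewrite ler_pdivrMr// -ler_pdivrMl// ltW// truncnS_gt.
apply: filterS (Hx m) => n.
have [_] := Fu n; rewrite -size_eq0 -lt0n => sF.
have s0 : 0 < (size (F n))%:R :> R by rewrite ltr0n.
rewrite -ler_pdivrMr// => /le_trans/(_ me); apply: le_trans.
rewrite distrC -[X in _ / X]gtr0_norm// -normf_div mulrBl.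
by rewrite mulrAC mulfV ?gt_eqF// mul1r [_^-1 * _]mulrC.
Qed.

Lemma ae_act (P : X -> Prop) (g : G) :
  {ae mu, forall x, P x} -> {ae mu, forall x, P (act g x)}.
Proof.
have [_ [_ [mact muact]]] := mp.
move=> [N [mN N0 PN]]; exists (act g @^-1` N); split.
- by rewrite -[X in measurable X]setTI; exact: mact.
- by rewrite muact.
- by move=> x /= nP; exact: PN.
Qed.

End convergence.

(** * Reduction from essentially bounded to bounded functions *)

Theorem theorem3 (R : realType) (G : groupType) (d : measure_display)
    (X : measurableType d) (mu : probability X R)
    (act : G -> X -> X) (F : nat -> seq G) (f : X -> R) :
  countable [set: G] ->
  Folner R F ->
  (forall alpha : R, 0 <= alpha < 1 ->
     cvg (series (fun n => alpha ^+ size (F n)) @ \oo)) ->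
  mp_action mu act ->
  Linfty mu f ->
  (forall eps : R, 0 < eps ->
     exists K : set G, finite_set K /\
       eps_independent mu f (sigma_translates act f K) eps) ->
  {ae mu, forall x,
     ((size (F n))%:R^-1 * \sum_(g <- F n) f (act g x))
       @[n --> \oo] --> Rintegral mu setT f}.
Proof.
move=> _ [Fu _] Fs mp [mf [M fM]] fK.
(* Replacing [f] by a clamped version makes it bounded everywhere without
   enlarging any of the sigma-algebras generated by its translates. *)
pose clamp y := Num.max (- `|M|) (Num.min `|M| y).
have clamp_le y : `|clamp y| <= `|M|.
  by rewrite ler_norml le_max lexx/= ge_max ge_min lexx/= andbT ge0_cp.
have clamp_id y : `|y| <= M -> clamp y = y.
  move=> /le_trans/(_ (ler_norm M)); rewrite ler_norml => /andP[lo hi].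
  by rewrite /clamp min_r// max_r.
have mclamp : measurable_fun setT clamp.
  apply: measurable_maxr; first exact: measurable_cst.
  by apply: measurable_minr; first exact: measurable_cst.
pose f' := clamp \o f.
have f'b : bounded_measurable f'.
  by split; [exact: measurableT_comp|exists `|M| => x; exact: clamp_le].
have f'E B : measurable B -> \int[mu]_(x in B) f' x = \int[mu]_(x in B) f x.
  move=> mB; rewrite /Rintegral; congr fine; apply: ae_eq_integral => //.
  - by apply/measurable_EFinP/measurable_funTS; exact: f'b.1.
  - by apply/measurable_EFinP; exact: measurable_funTS.
  - by apply: filterS fM => x fxM _; rewrite /f' /= clamp_id.
have f'K e : 0 < e -> exists K : set G, finite_set K /\
    eps_independent mu f' (sigma_translates act f' K) e.
  move=> /fK[K [Kfin Ke]]; exists K; split=> // B SB B0.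
  rewrite !f'E//; last exact: (sigma_translates_measurable _ _ mp _ _ f'b.1 _ SB).
  by apply: Ke => //; exact: (sigma_translates_comp _ _ _ _ mclamp _ SB).
(* Indexing the elements of all [F n] by pairs [(n, i)] makes the exceptional null sets a countable
   family. Beyond the end of [F n] the default [1] only repeats the condition at the identity. *)
have fE : {ae mu, forall x n i,
    f' (act (nth 1%g (F n) i) x) = f (act (nth 1%g (F n) i) x)}.
  apply: ae_foralln => n; apply: ae_foralln => i.
  apply: (ae_act mu act mp (fun x => f' x = f x)).
  by apply: filterS fM => x fxM; rewrite /f' /= clamp_id.
apply: filterS2 fE (ae_cvg_average_bounded mu act mp f' F f'b Fu Fs f'K) => x fE.
rewrite f'E//.
have -> // : (fun n => (size (F n))%:R^-1 * \sum_(g <- F n) f' (act g x)) =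
    (fun n => (size (F n))%:R^-1 * \sum_(g <- F n) f (act g x)).
apply/funext => n; congr (_ * _); apply: eq_big_seq => g gF.
by have := fE n (index g (F n)); rewrite nth_index.
Qed.
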